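(* Let $\Gamma$ be a countable amenable group. Then the action $\Gamma\curvearrowright\beta\Gamma$ has dynamical comparison. Consequently, for any two subsets $A,B$ of $\Gamma$ such that $\mu(A)<\mu(B)$ for every $\Gamma$-invariant finitely additive probability measure $\mu$ on $\Gamma$, there exist $A_1,\dots,A_n\subseteq\Gamma$ and $\gamma_1,\dots,\gamma_n\in\Gamma$ with $A=\bigsqcup_{i=1}^nA_i$ and $\bigsqcup_{i=1}^n\gamma_iA_i\subseteq B$.
   Context: $\beta\Gamma$ is the Stone–Čech compactification of the discrete group $\Gamma$, on which $\Gamma$ acts by extending left translation. For an action $\alpha$ of $\Gamma$ on a compact Hausdorff $0$-dimensional space $X$, dynamical comparison means: for all nonempty clopen $A,B\subseteq X$ with $\mu(A)<\mu(B)$ for every $\alpha$-invariant Radon probability measure $\mu$ on $X$, there exist a clopen partition $A=\bigsqcup_{i=1}^nA_i$ and $\gamma_1,\dots,\gamma_n\in\Gamma$ such that the sets $\alpha(\gamma_i)A_i$ are pairwise disjoint and contained in $B$ (equivalently $[A]\le[B]$ in the clopen type semigroup). In the second statement, the union $\bigsqcup_i \gamma_i A_i$ is a disjoint union. *)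

(* Defs.v *)
From HB Require Import structures.
From mathcomp Require Import all_boot all_order all_algebra.
From mathcomp Require Import all_classical all_reals all_analysis.
From mathcomp Require Import Rstruct Rstruct_topology.
Set Implicit Arguments. Unset Strict Implicit. Unset Printing Implicit Defensive.
Import Order.TTheory GRing.Theory Num.Theory.
Local Open Scope classical_set_scope.
Local Open Scope ring_scope.

Record is_group (G : Type) (mul : G -> G -> G) (one : G) (inv : G -> G) : Prop := {
  grp_mulA : forall x y z, mul x (mul y z) = mul (mul x y) z;
  grp_mul1 : forall x, mul one x = x;
  grp_mulV : forall x, mul (inv x) x = one }.

Definition inv_fa_prob (G : Type) (mul : G -> G -> G) (m : set G -> Rdefinitions.R) :=
  [/\ forall A, 0 <= m A, m setT = 1,
      (forall A B, A `&` B = set0 -> m (A `|` B) = m A + m B) &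
      (forall g A, m (mul g @` A) = m A)].

Definition amenable (G : Type) (mul : G -> G -> G) :=
  exists m, inv_fa_prob mul m.

Section Dyn.
Variables (G X : Type) (opn : set (set X)) (act : G -> X -> X).

Definition clopen (U : set X) := opn U /\ opn (~` U).
Definition borel : set (set X) := <<s opn >>.
Definition compact_in (K : set X) :=
  forall (I : Type) (U : I -> set X), (forall i, opn (U i)) ->
    K `<=` \bigcup_i U i ->
    exists2 D : set I, finite_set D & K `<=` \bigcup_(i in D) U i.

(** Radon probability measure (on the Borel sets; for a finite measure on a
    compact Hausdorff space: countably additive, inner regular by compact sets
    and outer regular by open sets). *)
Definition radon_prob (mu : set X -> Rdefinitions.R) :=
  [/\ forall E, borel E -> 0 <= mu E,
      mu setT = 1,
      (forall F : nat -> set X, (forall i, borel (F i)) ->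
          (forall i j, i <> j -> F i `&` F j = set0) ->
          (fun n => \sum_(i < n) mu (F i)) @ \oo --> mu (\bigcup_i F i)),
      (forall E, borel E -> forall e : Rdefinitions.R, 0 < e ->
          exists K, [/\ compact_in K, borel K, K `<=` E & mu E - e < mu K]) &
      (forall E, borel E -> forall e : Rdefinitions.R, 0 < e ->
          exists U, [/\ opn U, E `<=` U & mu U < mu E + e])].

Definition act_invariant (mu : set X -> Rdefinitions.R) :=
  forall g E, borel E -> mu (act g @` E) = mu E.

Definition dyn_comparison :=
  forall A B : set X, clopen A -> clopen B -> A !=set0 -> B !=set0 ->
    (forall mu, radon_prob mu -> act_invariant mu -> mu A < mu B) ->
    exists (n : nat) (P : nat -> set X) (g : nat -> G),
      [/\ forall i, (i < n)%N -> clopen (P i),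
          A = \bigcup_(i in [set k | (k < n)%N]) P i,
          (forall i j, (i < n)%N -> (j < n)%N -> i <> j -> P i `&` P j = set0),
          (forall i j, (i < n)%N -> (j < n)%N -> i <> j ->
              act (g i) @` P i `&` act (g j) @` P j = set0) &
          (forall i, (i < n)%N -> act (g i) @` P i `<=` B)].
End Dyn.

(** ---- The Stone-Cech compactification of a discrete set, as ultrafilters ---- *)
Lemma ultra_fmap (T U : Type) (f : T -> U) (F : set_system T) :
  UltraFilter F -> UltraFilter (f @ F).
Proof.
move=> FU; split; first exact: fmap_proper_filter.
move=> H HF sFH; rewrite predeqE => A; split; last exact: sFH.
move=> HA; have [//|FnA] := in_ultra_setVsetC (f @^-1` A) FU.
have HnA : H (~` A) by apply: sFH.
by have /filter_ex [? []] : H (A `&` (~` A)) by exact: filterI.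
Qed.

Record betaG (G : Type) := BetaPt { bpt : set_system G; bpt_ultra : UltraFilter bpt }.

Definition beta_open (G : Type) (U : set (betaG G)) :=
  forall p, U p -> exists A : set G, bpt p A /\ [set q | bpt q A] `<=` U.

Definition beta_act (G : Type) (mul : G -> G -> G) (g : G) (p : betaG G) : betaG G :=
  BetaPt (ultra_fmap (mul g) (bpt_ultra p)).

(* Main.v *)
Require Import Defs.
From HB Require Import structures.
From mathcomp Require Import all_boot all_order all_algebra.
From mathcomp Require Import all_classical all_reals all_analysis.
From mathcomp Require Import Rstruct Rstruct_topology.
From mathcomp Require Import finmap ring lra.
Import Order.TTheory GRing.Theory Num.Theory.
Import numFieldNormedType.Exports.
Local Open Scope classical_set_scope.
Local Open Scope ring_scope.
Set Implicit Arguments.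
Unset Strict Implicit.
Unset Printing Implicit Defensive.

(** Extend each invariant mean [m] on [G] to an invariant Radon measure on the
    Stone-Cech compactification with value [m A] on the clopen set of the
    ultrafilters containing [A]; comparison there thus reduces to comparison of
    subsets of [G].
    There, arbitrary pieces are allowed, so that [A] embeds piecewise into [B]
    as soon as the bipartite graph joining [a] to the points of [K a] in [B] has
    a matching of [A], for some finite [K]. By Hall's theorem and double
    counting, such a [K] exists as soon as some finitely supported weight [w]
    satisfies [sum_f w(f) 1_A(f g) <= sum_f w(f) 1_B(f g)] for all [g].
    If there is no such weight, a theorem of the alternative and a limit along
    an ultrafilter give a finitely additive probability [m] with
    [m (x B) <= m (x A)] for all [x]; averaging [m] over its translates by an
    invariant mean yields an invariant mean [M] with [M B <= M A]. *)

(** * Hall's theorem for locally finite countable graphs *)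

Section Hall.
Context {G : countType} (A : set G).
Implicit Types (N M : G -> {fset G}) (S T : {fset G}).

Definition nbh N S : {fset G} := (\bigcup_(a <- S) N a)%fset.

Definition hall N :=
  forall S, [set` S] `<=` A -> (#|` S| <= #|` nbh N S|)%N.

Definition remove_edge N (e : G * G) : G -> {fset G} :=
  fun x => if x == e.1 then (N x `\ e.2)%fset else N x.

Lemma nbhP N S b : reflect (exists2 a, a \in S & b \in N a) (b \in nbh N S).
Proof.
apply: (iffP (bigfcupP _ _ _ _)).
- by move=> [a /andP[aS _] bN]; exists a.
- by move=> [a aS bN]; exists a => //; rewrite aS.
Qed.

Lemma nbh_mono N M S : (forall a, a \in S -> (N a `<=` M a)%fset) ->
  (nbh N S `<=` nbh M S)%fset.
Proof.
move=> NM; apply/fsubsetP => b /nbhP[a aS bN]; apply/nbhP; exists a => //.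
exact: (fsubsetP (NM a aS)).
Qed.

Lemma hall_mono N M : (forall a, (N a `<=` M a)%fset) -> hall N -> hall M.
Proof.
move=> NM hN S SA; apply: leq_trans (hN S SA) _.
by apply: fsubset_leq_card; apply: nbh_mono.
Qed.

Lemma remove_edge_sub N e x : (remove_edge N e x `<=` N x)%fset.
Proof.
by rewrite /remove_edge; case: ifP => _; [exact: fsubD1set|exact: fsubset_refl].
Qed.

(* Edges are considered in the order of their codes, and each is removed when
   Hall's condition survives; neighbourhoods being finite, it survives in the
   limit. *)
Lemma hall_minimal N : hall N -> exists M,
  [/\ forall a, (M a `<=` N a)%fset, hall M &
      forall a b, b \in M a -> ~ hall (remove_edge M (a, b))].
Proof.
move=> hN.
pose step (k : nat) N0 : G -> {fset G} :=
    if (choice.unpickle k : option (G * G)) is Some e then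
  if `[< hall (remove_edge N0 e) >] then remove_edge N0 e else N0 else N0.
pose Ns := fix Ns (k : nat) : G -> {fset G} := if k is j.+1 then step j (Ns j) else N.
have step_sub k N0 a : (step k N0 a `<=` N0 a)%fset.
  rewrite /step; case: choice.unpickle => [e|]; last exact: fsubset_refl.
  by case: asboolP => _; [exact: remove_edge_sub|exact: fsubset_refl].
have hNs k : hall (Ns k).
  elim: k => [//|k IH] /=; rewrite /step; case: choice.unpickle => [e|//].
  by case: asboolP.
have Ns_le i j a : (i <= j)%N -> (Ns j a `<=` Ns i a)%fset.
  elim: j => [|j IH]; first by rewrite leqn0 => /eqP ->; exact: fsubset_refl.
  rewrite leq_eqVlt => /orP[/eqP -> |]; first exact: fsubset_refl.
  by rewrite ltnS => /IH; apply: fsubset_trans; exact: step_sub.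
pose M a := [fset b in N a | `[< forall k, b \in Ns k a >]]%fset.
have MN k a : (M a `<=` Ns k a)%fset.
  by apply/fsubsetP => b; rewrite !inE => /andP[_ /asboolP].
(* Each point of the finite set [N a] outside [M a] is gone from some stage on, so the decreasing
   [Ns k a] ends up inside [M a]. *)
have NM a : \forall k \near \oo, (Ns k a `<=` M a)%fset.
  suff : \forall k \near \oo, (\bigcap_(b in [set` N a])
      [set k | b \in Ns k a -> b \in M a]) k.
    apply: filterS => k kP; apply/fsubsetP => b bk; apply: kP => //=.
    exact: (fsubsetP (Ns_le 0%N k a _)).
  apply: filter_bigI => b bN.
  have [bM|bM] := boolP (b \in M a); first by exists 0%N => // k _ _.
  move: bM; rewrite !inE /= bN /= => /asboolPn /existsNP[k bk].
  exists k => // j /= kj bj; exfalso; apply: bk.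
  exact: (fsubsetP (Ns_le _ _ a kj)).
exists M; split.
- exact: (MN 0%N).
- move=> S SA.
  have : \forall k \near \oo, (\bigcap_(a in [set` S])
      [set k | (Ns k a `<=` M a)%fset]) k.
    by apply: filter_bigI => a _; exact: NM.
  move=> [k _ /(_ k (leqnn k)) kP].
  apply: leq_trans (hNs k S SA) _; apply: fsubset_leq_card.
  by apply: nbh_mono => a aS; exact: kP.
- move=> a b bM hM.
  (* The edge survived its own stage, yet its removal was acceptable there: Hall's condition passes
     from [remove_edge M (a, b)] up to the larger graph of that stage. *)
  have /= := fsubsetP (MN (choice.pickle (a, b)).+1 a) b bM.
  rewrite /step choice.pickleK; case: asboolP => [_|[]].
    by rewrite /remove_edge eqxx !inE eqxx.
  apply: hall_mono hM => x; rewrite /remove_edge; case: ifP => _; last exact: MN.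
  by apply: fsetSD; exact: MN.
Qed.

(* Rado's argument: if two edges at [a] could not be removed, adding the two
   witnessing violations contradicts the modularity of cardinality. *)
Lemma hall_minimal_le1 M : hall M ->
  (forall a b, b \in M a -> ~ hall (remove_edge M (a, b))) ->
  forall a x y, x \in M a -> y \in M a -> x = y.
Proof.
move=> hM mM a x y xM yM; apply: contrapT => /eqP xy.
(* A set violating Hall's condition after the removal must contain [a], the only vertex whose
   neighbourhood changed; [T] is that set without [a], which turns [<] into [<=]. *)
have viol z : z \in M a -> exists T, [/\ [set` (a |` T)%fset] `<=` A, a \notin T &
    (#|` (nbh M T `|` (M a `\ z))%fset| <= #|` T|)%N].
  move=> /mM /existsNP[S] /not_implyP[SA] /negP; rewrite -ltnNge => Slt.
  have aS : a \in S.
    apply: contraLR Slt => aS; rewrite -leqNgt; apply: leq_trans (hM S SA) _.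
    apply: fsubset_leq_card; apply: nbh_mono => c cS; rewrite /remove_edge.
    by case: eqP cS aS => [->|_] ; [move=> -> | rewrite fsubset_refl].
  exists (S `\ a)%fset; rewrite fsetD1K// !inE eqxx; split => //.
  move: Slt; rewrite (cardfsD1 a S) aS add1n ltnS; apply: leq_trans.
  apply: fsubset_leq_card; apply/fsubsetP => b.
  rewrite inE => /orP[/nbhP[c]|bz].
    rewrite !inE => /andP[ca cS] bc; apply/nbhP; exists c => //.
    by rewrite /remove_edge (negbTE ca).
  by apply/nbhP; exists a => //; rewrite /remove_edge eqxx.
have [T1 [T1A aT1 c1]] := viol x xM.
have [T2 [T2A aT2 c2]] := viol y yM.
have TA : [set` (a |` (T1 `|` T2))%fset] `<=` A.
  move=> c /=; rewrite !inE => /or3P[/eqP ->|c1'|c2'].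
  - by apply: T1A; rewrite /= !inE eqxx.
  - by apply: T1A; rewrite /= !inE c1' orbT.
  - by apply: T2A; rewrite /= !inE c2' orbT.
have IA : [set` (T1 `&` T2)%fset] `<=` A.
  by move=> c /=; rewrite inE => /andP[c1' _]; apply: T1A; rewrite /= !inE c1' orbT.
have := hM _ TA; rewrite cardfsU1 inE (negbTE aT1) (negbTE aT2) /= => hU.
have hI := hM _ IA.
set U1 := (nbh M T1 `|` (M a `\ x))%fset in c1.
set U2 := (nbh M T2 `|` (M a `\ y))%fset in c2.
(* As [x] and [y] differ, every point of [M a] lies in [U1] or in [U2]. *)
have sU : (nbh M (a |` (T1 `|` T2)) `<=` U1 `|` U2)%fset.
  apply/fsubsetP => b /nbhP[c]; rewrite !inE => /or3P[/eqP ->|cT|cT] bc.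
  - rewrite bc !andbT; have [-> |_] := eqVneq b x; last by rewrite orbT.
    by rewrite xy !orbT.
  - by have -> : b \in nbh M T1 by apply/nbhP; exists c.
  - have -> : b \in nbh M T2 by apply/nbhP; exists c.
    by rewrite !orbT.
have sI : (nbh M (T1 `&` T2) `<=` U1 `&` U2)%fset.
  apply/fsubsetP => b /nbhP[c]; rewrite !inE => /andP[cT1 cT2] bc.
  have -> : b \in nbh M T1 by apply/nbhP; exists c.
  by have -> : b \in nbh M T2 by apply/nbhP; exists c.
have := leq_add (leq_trans hU (fsubset_leq_card sU))
                (leq_trans hI (fsubset_leq_card sI)).
rewrite -addnA !cardfsUI add1n => /leq_trans/(_ (leq_add c1 c2)).
by rewrite ltnn.
Qed.

(** In a minimal graph [M a] is a singleton for [a] in [A]: Hall's condition at [a] makes it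
    nonempty, Rado's argument leaves one point. Hall's condition for pairs then gives
    injectivity. *)
Lemma hall_matching N : hall N -> exists phi : G -> G,
  (forall a, A a -> phi a \in N a) /\
  (forall a a', A a -> A a' -> phi a = phi a' -> a = a').
Proof.
move=> /hall_minimal[M [MN hM mM]].
have M1 a : A a -> exists b, M a = [fset b]%fset.
  move=> aA; have := hM [fset a]%fset.
  rewrite cardfs1 /nbh big_seq_fset1 => Mgt0.
  have : [set` [fset a]%fset] `<=` A by move=> x /=; rewrite inE => /eqP ->.
  move=> /Mgt0.
  rewrite cardfs_gt0 => /fset0Pn[b bM]; exists b.
  apply/fsetP => c; rewrite inE; apply/idP/eqP => [cM|-> //].
  exact: (hall_minimal_le1 hM mM cM bM).
have /boolp.choice[phi phiP] : forall a, exists b, A a -> M a = [fset b]%fset.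
  by move=> a; have [/M1[b ->]|nA] := pselect (A a); [exists b|exists a].
exists phi; split => [a aA|a a' aA a'A e].
  by apply: (fsubsetP (MN a)); rewrite phiP// inE.
apply: contrapT => /eqP aa'; have := hM [fset a; a']%fset.
rewrite cardfs2 aa' => /(_ _)/wrap[|].
  by move=> x /=; rewrite !inE => /orP[]/eqP ->.
suff -> : nbh M [fset a; a']%fset = [fset phi a]%fset by rewrite cardfs1.
apply/fsetP => b; rewrite inE; apply/nbhP/eqP => [[c]|->].
  by rewrite !inE => /orP[]/eqP ->; rewrite phiP// inE => /eqP; rewrite -?e.
by exists a; rewrite ?phiP// !inE eqxx.
Qed.

End Hall.

(** * Theorem of the alternative *)

Section ConvexAlternative.
Context {R : realType} {T : Type} (mix : R -> T -> T -> T).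
Implicit Types (D : set T) (s t : T -> R).

(** [mix c x y] stands for [c x + (1 - c) y]; the points will be set functions on [G]. *)
Definition mix_closed D :=
  forall c x y, 0 <= c <= 1 -> D x -> D y -> D (mix c x y).

Definition mix_affine s :=
  forall c x y, s (mix c x y) = c * s x + (1 - c) * s y.

Lemma mix_weights D s t x y (p q : R) : mix_closed D -> mix_affine s ->
  mix_affine t -> D x -> D y -> 0 < p -> 0 < q -> exists z,
  [/\ D z, s z = (p * s x + q * s y) / (p + q) &
      t z = (p * t x + q * t y) / (p + q)].
Proof.
move=> cD sa ta xD yD p0 q0; have pq : p + q != 0 by rewrite gt_eqF// addr_gt0.
exists (mix (p / (p + q)) x y); split.
- apply: cD => //; apply/andP; split; first by apply: divr_ge0; lra.
  by rewrite ler_pdivrMr ?addr_gt0// mul1r lerDl ltW.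
- by rewrite sa; field.
- by rewrite ta; field.
Qed.

(** Otherwise both functionals would be negative at some mixture of [x] and [y]. *)
Lemma cross_ratio_le D s t x y : mix_closed D -> mix_affine s -> mix_affine t ->
  (forall z, D z -> s z < 0 -> 0 <= t z) ->
  D x -> D y -> s x < 0 -> t y < 0 -> s x * t y <= s y * t x.
Proof.
move=> cD sa ta st xD yD sx ty.
have tx := st x xD sx.
have sy : 0 <= s y by rewrite leNgt; apply/negP => /(st y yD); rewrite leNgt ty.
rewrite leNgt; apply/negP => lt.
(* These weights give [s z] and [t z] the same numerator [s y * t x - s x * t y], negative by
   [lt]. *)
have [||z [zD sz tz]] := @mix_weights D s t x y (s y - t y) (t x - s x) cD sa ta xD yD.
- by lra.
- by lra.
have pq : 0 < s y - t y + (t x - s x) by lra.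
have : s z < 0 by rewrite sz pmulr_llt0 ?invr_gt0//; lra.
move=> /(st z zD); rewrite leNgt => /negP; apply.
by rewrite tz pmulr_llt0 ?invr_gt0//; lra.
Qed.

Lemma convex_alternative2 D s t : mix_closed D -> mix_affine s -> mix_affine t ->
  (forall z, D z -> s z < 0 -> 0 <= t z) ->
  exists a b, [/\ 0 <= a, 0 <= b, 0 < a + b &
    forall z, D z -> 0 <= a * s z + b * t z].
Proof.
move=> cD sa ta st.
have [tD|/existsNP[y /not_implyP[yD /negP]]] :=
  pselect (forall z, D z -> 0 <= t z).
  by exists 0, 1; split; [|by []|by rewrite add0r|by move=> z /tD; rewrite mul0r add0r mul1r].
rewrite -ltNge => ty.
(* With [a = 1], points with [s x < 0] force [b >= - s x / t x] and points with [t y < 0] force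
   [b <= s y / - t y]. By [cross_ratio_le] these bounds are compatible, so [b = sup L] will do. *)
pose L := [set r | exists x, [/\ D x, s x < 0 & r = - s x / t x]].
have [sD|/existsNP[x0 /not_implyP[x0D /negP]]] :=
  pselect (forall z, D z -> 0 <= s z).
  by exists 1, 0; split; [by []| |by rewrite addr0|by move=> z /sD; rewrite mul0r addr0 mul1r].
rewrite -ltNge => sx0.
have tpos x : D x -> s x < 0 -> 0 < t x.
  move=> xD sx; rewrite lt_neqAle eq_sym st// andbT; apply/eqP => tx.
  have := cross_ratio_le cD sa ta st xD yD sx ty.
  by rewrite tx mulr0 leNgt nmulr_rgt0// ty.
have Lle x' : D x' -> t x' < 0 -> ubound L (s x' / - t x').
  move=> x'D tx' _ [x [xD sx ->]].
  rewrite ler_pdivrMr ?tpos// mulrAC ler_pdivlMr ?oppr_gt0//.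
  by have := cross_ratio_le cD sa ta st xD x'D sx tx'; rewrite mulrNN.
have supL : has_sup L.
  by split; [exists (- s x0 / t x0), x0|exists (s y / - t y); exact: Lle].
have Lx0 : 0 < - s x0 / t x0 by rewrite divr_gt0 ?oppr_gt0 ?tpos.
have Lpos : 0 <= sup L.
  by apply: ltW; apply: lt_le_trans Lx0 _; apply: ub_le_sup; [exact: supL.2|exists x0].
exists 1, (sup L); split => //; first by rewrite ltr_pwDl.
move=> z zD; rewrite mul1r; have [sz|sz] := ltP (s z) 0.
  have : - s z / t z <= sup L by apply: ub_le_sup; [exact: supL.2|exists z].
  by rewrite ler_pdivrMr ?tpos//; lra.
have [tz|tz] := ltP (t z) 0; last by rewrite addr_ge0// mulr_ge0.
have : sup L <= s z / - t z by apply: ge_sup; [exact: supL.1|exact: Lle].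
by rewrite ler_pdivlMr ?oppr_gt0//; lra.
Qed.

(* Ville's theorem of the alternative, by induction on the number of
   functionals: restrict to the part of [D] where the last one is negative,
   then recombine by the two-dimensional case. *)
Lemma convex_alternative D (n : nat) (f : nat -> T -> R) :
  D !=set0 -> mix_closed D -> (forall i, mix_affine (f i)) ->
  (exists2 x, D x & forall i, (i < n)%N -> f i x < 0) \/
  (exists w : nat -> R, [/\ forall i, (i < n)%N -> 0 <= w i, 0 < \sum_(i < n) w i &
    forall x, D x -> 0 <= \sum_(i < n) w i * f i x]).
Proof.
move=> + + fa; elim: n D => [|n IH] D D0 cD; first by case: D0 => x xD; left; exists x.
pose D' := D `&` [set x | f n x < 0].
have [D'0|/set0P/negP/negPn/eqP D'0] := pselect (D' !=set0); last first.
  right; exists (fun i => (i == n)%:R); split => [i _||x xD].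
  - exact: ler0n.
  - by rewrite big_ord_recr /= eqxx ltr_pwDr// sumr_ge0.
  - rewrite big_ord_recr /= eqxx mul1r big1 ?add0r; last first.
      by move=> i _; rewrite ltn_eqF// mul0r.
    rewrite leNgt; apply/negP => fx.
    by have : D' x by []; rewrite D'0.
have cD' : mix_closed D'.
  move=> c x y /andP[c0 c1] [xD fx] [yD fy]; split; first by apply: cD => //; rewrite c0.
  by rewrite /= fa; move: fx fy => /=; nra.
have [[x [xD fx] xP]|[w [w0 sw wP]]] := IH D' D'0 cD'.
  left; exists x => // i; rewrite ltnS leq_eqVlt => /orP[/eqP ->//|]; exact: xP.
right; pose s x := \sum_(i < n) w i * f i x.
have sa : mix_affine s.
  move=> c x y; rewrite /s !mulr_sumr -big_split /=; apply: eq_bigr => i _.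
  by rewrite fa; ring.
(* By the choice of [w], [s] is nonnegative wherever [f n] is negative on [D], so the case of two
   functionals applies. *)
have [|a [b [a0 b0 ab abP]]] := convex_alternative2 cD sa (fa n).
  move=> z zD sz; rewrite leNgt; apply/negP => fz.
  by have := wP z (conj zD fz); rewrite leNgt sz.
exists (fun i => if (i < n)%N then a * w i else b); split => [i _||x xD].
- by case: ifP => ni //; rewrite mulr_ge0// w0.
- rewrite big_ord_recr /= ltnn.
  under eq_bigr => i _ do rewrite ltn_ord.
  rewrite -mulr_sumr; have [a_0|an0] := eqVneq a 0.
    by move: ab; rewrite a_0 mul0r !add0r.
  by rewrite ltr_pwDl// mulr_gt0// lt_neqAle eq_sym an0.
- rewrite big_ord_recr /= ltnn.
  under eq_bigr => i _ do rewrite ltn_ord -mulrA.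
  by rewrite -mulr_sumr; exact: abP.
Qed.

End ConvexAlternative.

(** * Integration against finitely additive probabilities *)

Section GeneralizedLimit.
Context {R : realType}.

Definition bounded_seq (u : nat -> R) := exists M : R, forall n, `|u n| <= M.

(** [L] is the limit along an ultrafilter refining [\oo]: bounded sequences live in a compact
    segment, hence converge along it. *)
Lemma generalized_limit : exists L : (nat -> R) -> R,
  [/\ forall u v, bounded_seq u -> bounded_seq v ->
        L (fun n => u n + v n) = L u + L v,
      forall u v, bounded_seq u -> bounded_seq v ->
        (\forall n \near \oo, u n <= v n) -> L u <= L v &
      forall c, L (fun=> c) = c].
Proof.
have [U [UU ooU]] := ultraFilterLemma eventually_filter.
have UP : ProperFilter U by exact: ultra_proper.
have cvgU u : bounded_seq u -> cvg (u @ U).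
  move=> [M uM]; have := @segment_compact R (- M) M.
  rewrite compact_ultra => /(_ (u @ U) (ultra_fmap u UU)).
  have : (u @ U) [set` `[- M, M]].
    rewrite /nbhs /=; suff -> : u @^-1` [set` `[- M, M]] = setT by exact: filterT.
    by apply/seteqP; split => // n _ /=; rewrite in_itv /= -ler_norml.
  by move=> uMM /(_ uMM)[l [_ ul]]; apply/cvg_ex; exists l.
exists (fun u => lim (u @ U)); split.
- by move=> u v bu bv; exact: limD (cvgU _ bu) (cvgU _ bv).
- move=> u v bu bv uv; apply: ler_lim; [exact: cvgU|exact: cvgU|].
  exact: ooU.
- by move=> c; exact: lim_cst.
Qed.

End GeneralizedLimit.

(** * Finitely additive probabilities and integrals of simple functions *)

Section FiniteAdditivity.
Context {R : realType}.
Context {G : Type}.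

Definition fa_prob (m : set G -> R) :=
  [/\ forall A, 0 <= m A, m setT = 1 &
      forall A B, A `&` B = set0 -> m (A `|` B) = m A + m B].

Section Content.
Context {m : set G -> R}.
Hypothesis mP : fa_prob m.

Lemma fa_ge0 A : 0 <= m A. Proof. by case: mP. Qed.
Lemma fa_setT : m setT = 1. Proof. by case: mP. Qed.
Lemma fa_setU A B : A `&` B = set0 -> m (A `|` B) = m A + m B.
Proof. by case: mP => _ _; exact. Qed.

Lemma fa_set0 : m set0 = 0.
Proof. by have := fa_setU (set0I set0); rewrite setU0; lra. Qed.

Lemma fa_le A B : A `<=` B -> m A <= m B.
Proof.
move=> AB; rewrite -(setDUK AB) fa_setU ?lerDl ?fa_ge0//.
by apply/seteqP; split => // x [? []].
Qed.

Lemma fa_le1 A : m A <= 1.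
Proof. by rewrite -fa_setT; exact: fa_le. Qed.

Lemma fa_setU_le A B : m (A `|` B) <= m A + m B.
Proof.
have -> : A `|` B = A `|` (B `\` A) by rewrite setUDr setDv setD0.
rewrite fa_setU; last by apply/seteqP; split => // x [? []].
by rewrite lerD2l; apply: fa_le; exact: subDsetl.
Qed.

Lemma fa_partition (T : finType) (v : G -> T) (E : set G) :
  m E = \sum_(t : T) m (E `&` v @^-1` [set t]).
Proof.
suff H (s : seq T) : uniq s ->
    m (E `&` [set x | v x \in s]) = \sum_(t <- s) m (E `&` v @^-1` [set t]).
  rewrite -[RHS]big_enum -H ?enum_uniq//; congr m.
  by apply/seteqP; split => [x Ex|x []//]; split => //=; rewrite mem_enum.
elim: s => [_|t s IH /= /andP[ts us]].
  rewrite big_nil -fa_set0; congr m; apply/seteqP; split => // x [_] /=.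
  by rewrite in_nil.
rewrite big_cons -IH// -fa_setU.
  congr m; rewrite -setIUr; congr (_ `&` _); apply/seteqP; split => x /=.
    by rewrite inE => /orP[/eqP ->|]; [left|right].
  by rewrite inE => -[->|->]; rewrite ?eqxx ?orbT.
apply/seteqP; split => // x [[_ /= xt] [_ /=]].
by rewrite xt (negbTE ts).
Qed.

(** The integral of [c \o u]; indexing the values by a finite type lets two functions be refined
    together by pairing. *)
Definition simple_integral (T : finType) (c : T -> R) (u : G -> T) :=
  \sum_(t : T) c t * m (u @^-1` [set t]).

(** Both sums are split over the common level sets of [u] and [v]: the hypothesis at one point
    settles a nonempty cell, and an empty cell has mass zero. The error is spread over the total
    mass [1]. *)
Lemma simple_integral_le (T T' : finType) (c : T -> R) (d : T' -> R)
    (u : G -> T) (v : G -> T') (e : R) :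
  (forall x, c (u x) <= d (v x) + e) ->
  simple_integral c u <= simple_integral d v + e.
Proof.
move=> cd; rewrite /simple_integral.
under eq_bigr => t _ do rewrite (fa_partition v) mulr_sumr.
under [in leRHS]eq_bigr => t _ do rewrite (fa_partition u) mulr_sumr.
rewrite [in leRHS]exchange_big /=.
have -> : e = \sum_(t : T) \sum_(t' : T') e * m (u @^-1` [set t] `&` v @^-1` [set t']).
  under eq_bigr => t _ do rewrite -mulr_sumr -fa_partition.
  rewrite -mulr_sumr; under eq_bigr => t _ do rewrite -[_ @^-1` _]setTI.
  by rewrite -fa_partition fa_setT mulr1.
rewrite -big_split /=; apply: ler_sum => t _.
rewrite -big_split /=; apply: ler_sum => t' _.
rewrite [X in d _ * m X]setIC -mulrDl.
have [->|/set0P[x [/= <- <-]]] := eqVneq (u @^-1` [set t] `&` v @^-1` [set t']) set0.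
  by rewrite fa_set0 !mulr0.
by rewrite ler_wpM2r// fa_ge0.
Qed.

Lemma simple_integral_pair (T T' : finType) (c : T -> R) (d : T' -> R)
    (u : G -> T) (v : G -> T') :
  simple_integral (fun p => c p.1 + d p.2) (fun x => (u x, v x))
    = simple_integral c u + simple_integral d v.
Proof.
(* The integral depends on the function only, not on its presentation, so both summands can be
   indexed by pairs. *)
have eqI (S S' : finType) (a : S -> R) (b : S' -> R) (f : G -> S) (g : G -> S') :
    (forall x, a (f x) = b (g x)) -> simple_integral a f = simple_integral b g.
  move=> ab; apply/eqP; rewrite eq_le; apply/andP; split.
    by rewrite -[leRHS]addr0; apply: simple_integral_le => x; rewrite ab addr0.
  by rewrite -[leRHS]addr0; apply: simple_integral_le => x; rewrite ab addr0.
rewrite (eqI _ _ c (fun p : T * T' => c p.1) u (fun x => (u x, v x)))//.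
rewrite (eqI _ _ d (fun p : T * T' => d p.2) v (fun x => (u x, v x)))//.
by rewrite /simple_integral -big_split /=; apply: eq_bigr => p _; rewrite mulrDl.
Qed.

Lemma simple_integral_cst (a : R) : simple_integral (fun=> a) (fun=> tt) = a.
Proof.
rewrite /simple_integral (bigD1 tt)//= big1 => [|[]//].
rewrite addr0 -[RHS]mulr1 -fa_setT; congr (_ * m _).
by apply/seteqP; split.
Qed.

End Content.

(** * Integrals of functions with values in the unit interval *)

Definition unit_fun (f : G -> R) := forall x, 0 <= f x <= 1.

(** Rounding down to multiples of [1 / n.+1]; there are [n.+2] grid points because [y = 1] rounds to
    itself. *)
Definition grid_floor (n : nat) (y : R) : 'I_n.+2 := inord (Num.truncn (n.+1%:R * y)).

Definition grid_value (n : nat) (k : 'I_n.+2) : R := k%:R / n.+1%:R.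

Lemma grid_floorP n y : 0 <= y <= 1 ->
  grid_value (grid_floor n y) <= y <= grid_value (grid_floor n y) + n.+1%:R^-1.
Proof.
move=> /andP[y0 y1]; have n0 : 0 < n.+1%:R :> R by rewrite ltr0n.
have ny0 : 0 <= n.+1%:R * y by rewrite mulr_ge0// ltW.
have /andP[t1 t2] := truncn_itv ny0.
rewrite /grid_value /grid_floor inordK; last first.
  rewrite ltnS -(ler_nat R); apply: le_trans t1 _.
  by rewrite -[leRHS]mulr1 ler_pM2l.
apply/andP; split; first by rewrite ler_pdivrMr// [leRHS]mulrC.
by rewrite -[X in _ + X]mul1r -mulrDl ler_pdivlMr// [leLHS]mulrC natr1 ltW.
Qed.

Definition grid_sum (m : set G -> R) (f : G -> R) (n : nat) : R :=
  @simple_integral m _ (@grid_value n) (fun x => grid_floor n (f x)).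

Section Integral.
Context {m : set G -> R} {L : (nat -> R) -> R}.
Hypothesis mP : fa_prob m.
Hypothesis LD : forall u v, bounded_seq u -> bounded_seq v ->
  L (fun n => u n + v n) = L u + L v.
Hypothesis Lle : forall u v, bounded_seq u -> bounded_seq v ->
  (\forall n \near \oo, u n <= v n) -> L u <= L v.
Hypothesis Lcst : forall c, L (fun=> c) = c.

(** Using [L] dispenses with a convergence proof for the grid sums. *)
Definition mean_integral (f : G -> R) := L (grid_sum m f).

Lemma grid_sum_bounded f : unit_fun f -> bounded_seq (grid_sum m f).
Proof.
move=> f01; exists 1 => n; rewrite ger0_norm; last first.
  by apply: sumr_ge0 => t _; rewrite mulr_ge0 ?(fa_ge0 mP)// divr_ge0 ?ler0n.
rewrite -[leRHS](simple_integral_cst mP) -[leRHS]addr0.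
apply: (simple_integral_le mP) => x; rewrite addr0.
have /andP[_ fx] := f01 x; apply: le_trans fx.
by have /andP[] := grid_floorP n (f01 x).
Qed.

(** The slack [2 / n.+1] covers the rounding of two functions, as additivity requires, and is
    eventually below any [e]. *)
Lemma generalized_limit_le u v : bounded_seq u -> bounded_seq v ->
  (forall n, u n <= v n + 2 / n.+1%:R) -> L u <= L v.
Proof.
move=> bu bv uv; apply/ler_addgt0Pr => e e0.
have be : bounded_seq (fun=> e) by exists `|e|.
rewrite -[X in _ + X](Lcst e) -LD//; apply: Lle => //.
  have [M vM] := bv; exists (M + `|e|) => n.
  by apply: le_trans (ler_normD _ _) _; rewrite lerD2r.
near=> n; apply: le_trans (uv n) _; rewrite lerD2l ler_pdivrMr ?ltr0n//.
rewrite mulrC -ler_pdivrMr//; apply: ltW; apply: lt_le_trans (truncnS_gt _) _.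
by rewrite ler_nat ltnS; near: n; exact: nbhs_infty_ge.
Unshelve. all: by end_near. Qed.

Lemma mean_integral_le f g : unit_fun f -> unit_fun g ->
  (forall x, f x <= g x) -> mean_integral f <= mean_integral g.
Proof.
move=> f01 g01 fg; apply: generalized_limit_le; try exact: grid_sum_bounded.
move=> n; apply: (simple_integral_le mP) => x.
have /andP[fl _] := grid_floorP n (f01 x).
have /andP[_ gr] := grid_floorP n (g01 x).
have : 0 <= n.+1%:R^-1 :> R by rewrite invr_ge0 ler0n.
by have := fg x; move: fl gr; move: (n.+1%:R^-1) => i; lra.
Qed.

Lemma mean_integralD f g h : unit_fun f -> unit_fun g -> unit_fun h ->
  (forall x, h x = f x + g x) ->
  mean_integral h = mean_integral f + mean_integral g.
Proof.
move=> f01 g01 h01 hfg; have bf := grid_sum_bounded f01.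
have bg := grid_sum_bounded g01; have bh := grid_sum_bounded h01.
have bfg : bounded_seq (fun n => grid_sum m f n + grid_sum m g n).
  have [M fM] := bf; have [N gN] := bg; exists (M + N) => n.
  by apply: le_trans (ler_normD _ _) _; exact: lerD.
rewrite /mean_integral -LD//.
have i0 n : 0 <= n.+1%:R^-1 :> R by rewrite invr_ge0 ler0n.
apply/eqP; rewrite eq_le; apply/andP; split;
  apply: generalized_limit_le => // n; rewrite /grid_sum -(simple_integral_pair mP);
  apply: (simple_integral_le mP) => x /=;
  have := grid_floorP n (f01 x); have := grid_floorP n (g01 x);
  have := grid_floorP n (h01 x); have := hfg x; have := i0 n; move: (n.+1%:R^-1) => i; lra.
Qed.

Lemma mean_integral1 : mean_integral (fun=> 1) = 1.
Proof.
have f01 : unit_fun (fun=> 1) by move=> x; rewrite ler01 lexx.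
have b1 : bounded_seq (fun=> 1 : R) by exists `|1|.
have bf := grid_sum_bounded f01.
have i0 n : 0 <= n.+1%:R^-1 :> R by rewrite invr_ge0 ler0n.
rewrite -[RHS](Lcst 1); apply/eqP; rewrite eq_le; apply/andP; split;
  apply: generalized_limit_le => // n.
- rewrite -[X in _ <= X + _](simple_integral_cst mP 1).
  apply: (simple_integral_le mP) => x /=.
  by have := grid_floorP n (f01 x); have := i0 n; move: (n.+1%:R^-1) => i; lra.
- rewrite -[leLHS](simple_integral_cst mP 1).
  apply: (simple_integral_le mP) => x /=.
  by have := grid_floorP n (f01 x); have := i0 n; move: (n.+1%:R^-1) => i; lra.
Qed.

Lemma fa_bounded_seq (p : nat -> set G -> R) E :
  (forall n, fa_prob (p n)) -> bounded_seq (fun n => p n E).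
Proof.
move=> pP; exists 1 => n.
by rewrite ger0_norm ?(fa_ge0 (pP n)) ?(fa_le1 (pP n)).
Qed.

Lemma fa_prob_generalized_limit (p : nat -> set G -> R) :
  (forall n, fa_prob (p n)) -> fa_prob (fun E => L (fun n => p n E)).
Proof.
move=> pP; have bp E := fa_bounded_seq E pP.
split=> [E||E F EF].
- rewrite -[X in X <= _](Lcst 0); apply: Lle => //; first by exists `|0 : R|.
  by exists 0%N => // n _; exact: fa_ge0.
- rewrite -[RHS](Lcst 1); congr L; apply/funext => n; exact: fa_setT.
- by rewrite -LD//; congr L; apply/funext => n; exact: fa_setU.
Qed.

End Integral.
End FiniteAdditivity.

(** * Ultrafilters and Radon measures *)

Section StoneCech.
Context {G : Type}.
Implicit Types (p q : betaG G) (A B : set G) (U V K : set (betaG G)).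

(** The closure of [A] in the Stone-Cech compactification; the lemmas below identify the clopen
    algebra with the subsets of [G]. *)
Definition hat A : set (betaG G) := [set p | bpt p A].

Definition beta_of (x : G) : betaG G := BetaPt (principal_filter_ultra x).

Definition trace (U : set (betaG G)) : set G := [set x | U (beta_of x)].

Lemma bpt_proper p : ProperFilter (bpt p).
Proof. by have := bpt_ultra p => ?; exact: ultra_proper. Qed.

Lemma betaG_ext p q : (forall A, bpt p A <-> bpt q A) -> p = q.
Proof.
case: p q => [F FU] [F' F'U] /= FF'.
have e : F = F' by apply/funext => A; apply/propext; exact: FF'.
by case: _ / e F'U {FF'} => F'U; congr BetaPt; exact: Prop_irrelevance.
Qed.

Lemma hat_beta_of A x : hat A (beta_of x) <-> A x.
Proof. by split => [/principal_filterP|Ax] //; exact/principal_filterP. Qed.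

Lemma hatT : hat setT = setT.
Proof.
by apply/seteqP; split => // p _; have := bpt_proper p => ?; exact: filterT.
Qed.

Lemma hat0 : hat set0 = set0.
Proof.
by apply/seteqP; split => // p; have := bpt_proper p => ?; exact: filter_not_empty.
Qed.

Lemma hatS A B : A `<=` B -> hat A `<=` hat B.
Proof. by move=> AB p; have := bpt_proper p => ?; exact: filterS. Qed.

Lemma hatI A B : hat (A `&` B) = hat A `&` hat B.
Proof.
apply/seteqP; split => p.
  by move=> AB; split; apply: hatS AB; [exact: subIsetl|exact: subIsetr].
by have := bpt_proper p => ? [? ?]; exact: filterI.
Qed.

Lemma hatC A : hat (~` A) = ~` hat A.
Proof.
apply/seteqP; split => p.
  move=> nA pA; have : hat (~` A `&` A) p by rewrite hatI.
  by rewrite setICl hat0.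
by move=> npA; have [//|//] := in_ultra_setVsetC A (bpt_ultra p).
Qed.

Lemma hatU A B : hat (A `|` B) = hat A `|` hat B.
Proof. by rewrite -[A `|` B]setCK setCU hatC hatI !hatC setCI !setCK. Qed.

Lemma subset_hat A B : hat A `<=` hat B -> A `<=` B.
Proof. by move=> AB x /hat_beta_of /AB /hat_beta_of. Qed.

Lemma hat_inj A B : hat A = hat B -> A = B.
Proof. by move=> AB; apply/seteqP; split; apply: subset_hat; rewrite AB. Qed.

Lemma open_hat A : beta_open (hat A).
Proof. by move=> p pA; exists A; split. Qed.

Lemma open_setT : beta_open [set: betaG G].
Proof. by rewrite -hatT; exact: open_hat. Qed.

Lemma open_setI U V : beta_open U -> beta_open V -> beta_open (U `&` V).
Proof.
move=> oU oV p [/oU[A [pA AU]] /oV[B [pB BV]]]; exists (A `&` B).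
have pAB : hat (A `&` B) p by rewrite hatI.
split => //; rewrite -/(hat (A `&` B)) hatI => q [qA qB].
by split; [exact: AU|exact: BV].
Qed.

Lemma open_bigcup (I : Type) (F : I -> set (betaG G)) :
  (forall i, beta_open (F i)) -> beta_open (\bigcup_i F i).
Proof.
move=> oF p [i _ /oF[A [pA AF]]]; exists A; split => //.
by move=> q /AF; exists i.
Qed.

(** A basic neighbourhood inside [U] comes from a subset of [trace U], one inside the complement
    from a set disjoint from it. *)
Lemma clopenE U : Defs.clopen (@beta_open G) U -> U = hat (trace U).
Proof.
move=> [oU oCU]; apply/seteqP; split => p.
  move=> /oU[A [pA AU]]; apply: hatS pA => x Ax; apply: AU.
  by apply/hat_beta_of.
move=> pU; apply: contrapT => /oCU[A [pA AU]].
have : hat (A `&` trace U) p by rewrite hatI.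
suff -> : A `&` trace U = set0 by rewrite hat0.
by apply/seteqP; split => // x [/hat_beta_of /AU].
Qed.

Lemma clopen_hat A : Defs.clopen (@beta_open G) (hat A).
Proof. by split; rewrite -?hatC; exact: open_hat. Qed.

(* Compactness of [hat A], with open covers replaced by ideals of subsets of [G]. *)
Lemma hat_compact (I : set (set G)) A :
  I set0 -> (forall B C, B `<=` C -> I C -> I B) ->
  (forall B C, I B -> I C -> I (B `|` C)) ->
  (forall p, hat A p -> exists2 C, I C & hat C p) -> I A.
Proof.
move=> I0 IS IU AI; apply: contrapT => nIA.
(* Sets missing only an ideal part of [A] form a proper filter; an ultrafilter above it lies in
   [hat A] but in no [hat C] with [C] in the ideal. *)
have FI : ProperFilter [set E | I (A `\` E)].
  split; first by rewrite /= setD0.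
  split=> [|E F IE IF|E F EF IE] /=.
  - by rewrite setDT.
  - by rewrite setDIr; exact: IU.
  - by apply: IS IE; exact: setDS.
have [F [FU sF]] := ultraFilterLemma FI.
have [|C IC FC] := AI (BetaPt FU); first by apply: sF; rewrite /= setDv.
have : hat (~` C) (BetaPt FU).
  by apply: sF; apply: IS IC => x [_ /contrapT].
by rewrite hatC.
Qed.

(** The ideal consists of the [C] such that finitely many [U i] cover the part of [K] in [hat C]; a
    point off [K] has a basic neighbourhood missing [K]. *)
Lemma closed_compact K : beta_open (~` K) -> compact_in (@beta_open G) K.
Proof.
move=> oCK T U oU KU.
pose I := [set C | exists2 D : set T, finite_set D &
  hat C `&` K `<=` \bigcup_(i in D) U i].
suff : I setT by move=> [D fD]; rewrite hatT setTI => KD; exists D.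
apply: hat_compact.
- by exists set0; [exact: finite_set0|rewrite hat0 set0I].
- move=> B C BC [D fD CD]; exists D => //.
  by move=> p [pB pK]; apply: CD; split => //; exact: hatS pB.
- move=> B C [D fD BD] [E fE CE]; exists (D `|` E); first by rewrite finite_setU.
  by rewrite bigcup_setU hatU setIUl; exact: setUSS.
- move=> p _; have [pK|/oCK[C [pC CK]]] := pselect (K p).
    have [i _ pU] := KU p pK; have [C [pC CU]] := oU i p pU; exists C => //.
    exists [set i]; first exact: finite_set1.
    by move=> q [/CU qU _]; exists i.
  exists C => //; exists set0; first exact: finite_set0.
  by move=> q [/CK].
Qed.

Lemma beta_borel_open U : beta_open U -> borel (@beta_open G) U.
Proof. by move=> oU; exact: sub_sigma_algebra. Qed.

Lemma beta_borelC U : borel (@beta_open G) U -> borel (@beta_open G) (~` U).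
Proof.
have [_ + _] := smallest_sigma_algebra [set: betaG G] (@beta_open G).
by rewrite -setTD; apply.
Qed.

End StoneCech.

(** * Extension of a finitely additive probability to a Radon measure *)

Section RadonExtension.
Context {R : realType} {G : Type} {m : set G -> R}.
Hypothesis mP : fa_prob m.
Implicit Types (A B : set G) (U V E : set (betaG G)).

Definition inner_mass U := sup [set m A | A in [set A | hat A `<=` U]].

(* The outer measure is built from open sets, not from countable clopen covers:
   an open subset of [betaG G] need not be a countable union of clopen sets. *)
Definition outer_mass E :=
  inf [set inner_mass U | U in [set U | beta_open U /\ E `<=` U]].

Let inner_has_sup U : has_sup [set m A | A in [set A | hat A `<=` U]].
Proof.
split; first by exists (m set0), set0 => //=; rewrite hat0.
by exists 1 => _ [A _ <-]; exact: fa_le1.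
Qed.

Lemma inner_mass_ge A U : hat A `<=` U -> m A <= inner_mass U.
Proof. by move=> AU; apply: (ub_le_sup (inner_has_sup U).2); exists A. Qed.

Lemma inner_mass_le U r : (forall A, hat A `<=` U -> m A <= r) -> inner_mass U <= r.
Proof. by move=> Ur; apply: (ge_sup (inner_has_sup U).1) => _ [A AU <-]; exact: Ur. Qed.

Lemma inner_mass_approx U e : 0 < e -> exists2 A, hat A `<=` U & inner_mass U - e < m A.
Proof.
by move=> e0; have [_ [A AU <-] mA] := sup_adherent e0 (inner_has_sup U); exists A.
Qed.

Lemma inner_mass_ge0 U : 0 <= inner_mass U.
Proof. by rewrite -(fa_set0 mP); apply: inner_mass_ge; rewrite hat0. Qed.

Let outer_has_inf E :
  has_inf [set inner_mass U | U in [set U | beta_open U /\ E `<=` U]].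
Proof.
split; first by exists (inner_mass setT), setT => //; split => //; exact: open_setT.
by exists 0 => _ [U _ <-]; exact: inner_mass_ge0.
Qed.

Lemma outer_mass_le E U : beta_open U -> E `<=` U -> outer_mass E <= inner_mass U.
Proof. by move=> oU EU; apply: (ge_inf (outer_has_inf E).2); exists U. Qed.

Lemma outer_mass_ge E r :
  (forall U, beta_open U -> E `<=` U -> r <= inner_mass U) -> r <= outer_mass E.
Proof.
by move=> rE; apply: (lb_le_inf (outer_has_inf E).1) => _ [U [oU EU] <-]; exact: rE.
Qed.

Lemma outer_mass_approx E e : 0 < e ->
  exists U, [/\ beta_open U, E `<=` U & inner_mass U < outer_mass E + e].
Proof.
move=> e0; have [_ [U [oU EU] <-] mU] := inf_adherent e0 (outer_has_inf E).
by exists U.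
Qed.

Lemma outer_mass_ge0 E : 0 <= outer_mass E.
Proof. by apply: outer_mass_ge => U _ _; exact: inner_mass_ge0. Qed.

Lemma outer_mass_mono E F : E `<=` F -> outer_mass E <= outer_mass F.
Proof.
move=> EF; apply: outer_mass_ge => U oU FU; apply: outer_mass_le => //.
exact: subset_trans FU.
Qed.

Lemma outer_mass_open U : beta_open U -> outer_mass U = inner_mass U.
Proof.
move=> oU; apply/eqP; rewrite eq_le outer_mass_le//=.
apply: outer_mass_ge => V oV UV; apply: inner_mass_le => A AU.
by apply: inner_mass_ge; exact: subset_trans UV.
Qed.

Lemma outer_mass_hat A : outer_mass (hat A) = m A.
Proof.
rewrite outer_mass_open; last exact: open_hat.
apply/eqP; rewrite eq_le inner_mass_ge ?andbT//.
by apply: inner_mass_le => B /subset_hat; exact: fa_le.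
Qed.

Lemma outer_mass_setT : outer_mass setT = 1.
Proof. by rewrite -hatT outer_mass_hat; exact: fa_setT. Qed.

(** By compactness [hat A] is covered by finitely many [hat (D i)] with [hat (D i)] inside [U i],
    and [m] is finitely subadditive. *)
Lemma inner_mass_bigcup (U : nat -> set (betaG G)) A :
  (forall i, beta_open (U i)) -> hat A `<=` \bigcup_i U i ->
  exists n, m A <= \sum_(i < n) inner_mass (U i).
Proof.
move=> oU AU.
pose I := [set C | exists n (D : nat -> set G), (forall i, hat (D i) `<=` U i) /\
  C `<=` \bigcup_(i in [set k | (k < n)%N]) D i].
have [n [D [DU AD]]] : I A.
  apply: hat_compact.
  - by exists 0%N, (fun=> set0); split => // i; rewrite hat0.
  - move=> B C BC [n [D [DU CD]]]; exists n, D; split => //.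
    exact: subset_trans CD.
  - move=> B C [n [D [DU BD]]] [k [E [EU CE]]].
    exists (maxn n k), (fun i => D i `|` E i); split.
      by move=> i; rewrite hatU subUset.
    move=> x [/BD[i /= ni Dx]|/CE[i /= ki Ex]].
      by exists i; [rewrite /= leq_max ni|left].
    by exists i; [rewrite /= leq_max ki orbT|right].
  - move=> p /AU[i _ pU]; have [C [pC CU]] := oU i p pU; exists C => //.
    exists i.+1, (fun j => if j == i then C else set0); split.
      by move=> j; case: eqP => [->//|_]; rewrite hat0.
    by move=> x Cx; exists i => //=; rewrite eqxx.
exists n; apply: le_trans (fa_le mP AD) _.
elim: n {AD} => [|n IH].
  by rewrite big_ord0 (_ : \bigcup_(_ in _) _ = set0) ?(fa_set0 mP)// bigcup0.
rewrite big_ord_recr /=.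
apply: (@le_trans _ _ (m (\bigcup_(i in [set k | (k < n)%N]) D i `|` D n))).
  apply: (fa_le mP) => x [i /= + Dx]; rewrite ltnS leq_eqVlt.
  by move=> /orP[/eqP <-|ni]; [right|left; exists i].
by apply: le_trans (fa_setU_le mP _ _) _; rewrite lerD// inner_mass_ge.
Qed.

(** Extended real values give access to the Caratheodory theory of outer measures. *)
Definition outer_emass E : \bar R := (outer_mass E)%:E.

Let outer_emass0 : outer_emass set0 = 0%E.
Proof. by rewrite /outer_emass -hat0 outer_mass_hat (fa_set0 mP). Qed.

Let outer_emass_ge0 E : (0 <= outer_emass E)%E.
Proof. by rewrite lee_fin outer_mass_ge0. Qed.

Let outer_emass_mono : {homo outer_emass : E F / E `<=` F >-> (E <= F)%E}.
Proof. by move=> E F EF; rewrite lee_fin outer_mass_mono. Qed.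

Let outer_emass_sigma_subadditive : sigma_subadditive outer_emass.
Proof.
move=> F; apply/lee_addgt0Pr => e e0.
apply: le_trans (epsilon_trick xpredT (fun n => outer_emass_ge0 (F n)) (ltW e0)).
have ei i : 0 < e / (2 ^ i.+1)%:R by rewrite divr_gt0// ltr0n expn_gt0.
have /boolp.choice[U UP] i := outer_mass_approx (F i) (ei i).
have oU i : beta_open (U i) by have [] := UP i.
set S := (X in (_ <= X)%E).
(* A clopen set inside the union meets only finitely many terms of the series in its bound. *)
have US A : hat A `<=` \bigcup_i U i -> ((m A)%:E <= S)%E.
  move=> /(inner_mass_bigcup oU)[n mA].
  apply: (@le_trans _ _ (\sum_(0 <= i < n) (outer_emass (F i) + (e / (2 ^ i.+1)%:R)%:E))%E).
    rewrite big_mkord /outer_emass; under eq_bigr => i _ do rewrite -EFinD.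
    rewrite sumEFin lee_fin; apply: le_trans mA _; apply: ler_sum => i _.
    by apply: ltW; have [] := UP i.
  apply: nneseries_lim_ge => i _ _.
  by rewrite adde_ge0// lee_fin ltW.
apply: (@le_trans _ _ (inner_mass (\bigcup_i U i))%:E).
  rewrite lee_fin; apply: outer_mass_le; first exact: open_bigcup.
  by move=> p [i _ pF]; exists i => //; have [_ + _] := UP i; apply.
case: S US => [s| |] US; last 2 first.
- by rewrite leey.
- by have := US set0; rewrite hat0 => /(_ (@sub0set _ _)); rewrite leeNy_eq.
by rewrite lee_fin; apply: inner_mass_le => A /US; rewrite lee_fin.
Qed.

HB.instance Definition _ := isOuterMeasure.Build R (betaG G) outer_emass
  outer_emass0 outer_emass_ge0 outer_emass_mono outer_emass_sigma_subadditive.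

(** Take an open [V] around [E] and a clopen [hat A] filling [V] and [U]'s intersection, each up to
    [e / 2]. What lies in [E] outside [U] is in [V] minus [hat A], of mass at most
    [inner_mass V - m A]. *)
Lemma outer_emass_open_measurable U : beta_open U ->
  caratheodory_measurable outer_emass U.
Proof.
move=> oU; apply: le_caratheodory_measurable => E.
rewrite /= /outer_emass -EFinD lee_fin; apply/ler_addgt0Pr => e e0.
have e2 : 0 < e / 2 by rewrite divr_gt0.
have [V [oV EV Vlt]] := outer_mass_approx E e2.
have [A AVU Agt] := inner_mass_approx (V `&` U) e2.
have oVA : beta_open (V `&` hat (~` A)) by apply: open_setI => //; exact: open_hat.
have EU : outer_mass (E `&` U) <= inner_mass (V `&` U).
  by apply: outer_mass_le; [exact: open_setI|exact: setSI].
have EnU : outer_mass (E `&` ~` U) <= inner_mass (V `&` hat (~` A)).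
  apply: outer_mass_le => //; apply: setISS => //.
  by rewrite hatC; apply: subsetC => p /AVU[].
have : inner_mass (V `&` hat (~` A)) <= inner_mass V - m A.
  apply: inner_mass_le => C CVA; rewrite lerBrDr -(fa_setU mP).
    by apply: inner_mass_ge; rewrite hatU subUset; split => p; [move/CVA => []|move/AVU => []].
  apply: hat_inj; rewrite hat0 hatI; apply/seteqP; split => // p [/CVA[_ +] pA].
  by rewrite hatC.
lra.
Qed.

Lemma outer_emass_borel E : borel (@beta_open G) E ->
  caratheodory_measurable outer_emass E.
Proof.
apply: smallest_sub => [|U]; last exact: outer_emass_open_measurable.
split; first exact: caratheodory_measurable_set0.
- by move=> A mA; rewrite setTD; exact: caratheodory_measurable_setC.
- exact: caratheodory_measurable_bigcup.
Qed.

Lemma outer_mass_setC E : borel (@beta_open G) E ->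
  outer_mass (~` E) = 1 - outer_mass E.
Proof.
move=> /outer_emass_borel/(_ setT); rewrite !setTI /outer_emass -EFinD outer_mass_setT.
by case=> ->; rewrite addrC addKr.
Qed.

Lemma outer_mass_sigma_additive (F : nat -> set (betaG G)) :
  (forall i, borel (@beta_open G) (F i)) ->
  (forall i j, i <> j -> F i `&` F j = set0) ->
  (fun n => \sum_(i < n) outer_mass (F i)) @ \oo --> outer_mass (\bigcup_i F i).
Proof.
move=> bF dF; have cF i := outer_emass_borel (bF i).
have tF : trivIset setT F.
  by apply/trivIsetP => i j _ _ /eqP; exact: dF.
have sF : (\sum_(k <oo) outer_emass (F k) = outer_emass (\bigcup_i F i))%E.
  apply/eqP; rewrite eq_le outer_measure_sigma_subadditive andbT.
  have := caratheodory_lime_le cF tF (\bigcup_i F i).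
  rewrite setICr outer_measure0 adde0.
  by under eq_eseriesr => k _ do rewrite (setIidr (bigcup_sup _))//.
have : (fun n => \sum_(0 <= i < n) outer_emass (F i))%E @ \oo
         --> (outer_mass (\bigcup_i F i))%:E.
  rewrite -[X in _ --> X]sF; apply: is_cvg_nneseries => n _ _; exact: outer_emass_ge0.
move=> /fine_cvg; apply: cvg_trans; apply: near_eq_cvg; apply: nearW => n /=.
by rewrite big_mkord /outer_emass sumEFin.
Qed.

End RadonExtension.

(** * Comparison *)

Section Translates.
Context {G : countType} {mul : G -> G -> G} {one : G} {inv : G -> G}.
Hypothesis GP : is_group mul one inv.

Lemma mulK x : cancel (mul x) (mul (inv x)).
Proof. by move=> y; rewrite (grp_mulA GP) (grp_mulV GP) (grp_mul1 GP). Qed.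

(** The axioms give left inverses; the other side follows as multiplication by [inv x] is
    injective. *)
Lemma mulVK x : cancel (mul (inv x)) (mul x).
Proof. by move=> y; apply: (can_inj (mulK (inv x))); rewrite mulK. Qed.

Lemma mul_inj x : injective (mul x).
Proof. exact: can_inj (mulK x). Qed.

Lemma translateE x (E : set G) : mul x @` E = [set y | E (mul (inv x) y)].
Proof.
apply/seteqP; split => [_ [y Ey <-]|y Ey] /=; first by rewrite mulK.
by exists (mul (inv x) y) => //; rewrite mulVK.
Qed.

(** The points of [B] in [K a], with [K] the finite set of all [e i (e j)^-1]. *)
Definition reach (n : nat) (e : nat -> G) (B : set G) (a : G) : {fset G} :=
  [fset b in [seq mul (e i) (mul (inv (e j)) a) | i <- iota 0 n, j <- iota 0 n]
   | `[< B b >]]%fset.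

(* Double counting: summing the weighted densities of [A] and [B] along the
   finite pattern [e] over all its translates meeting a finite [S]. *)
Lemma hall_of_weights (A B : set G) (n : nat) (e : nat -> G)
    (w : nat -> Rdefinitions.R) :
  (forall i, (i < n)%N -> 0 <= w i) -> 0 < \sum_(i < n) w i ->
  (forall g, \sum_(i < n) w i * (`[< A (mul (e i) g) >])%:R
          <= \sum_(i < n) w i * (`[< B (mul (e i) g) >])%:R) ->
  hall A (reach n e B).
Proof.
move=> w0 sw AB S SA.
(* The [g] whose pattern [e i g] meets [S]; each [s] in [S] occurs as [e i g] for every [i < n]. *)
pose P := undup [seq mul (inv (e i)) s | i <- iota 0 n, s <- enum_fset S].
have sumP (b : G -> bool) : \sum_(g <- P) (b g)%:R = (count b P)%:R :> Rdefinitions.R.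
  by rewrite -natr_sum -sum1_count [in RHS]big_mkcond.
have SP i : (i < n)%N -> (#|` S| <= count (fun g => mul (e i) g \in S) P)%N.
  move=> ni; rewrite -size_filter -(size_map (mul (inv (e i))) (enum_fset S)).
  apply: uniq_leq_size; first by rewrite map_inj_uniq ?fset_uniq//; exact: mul_inj.
  move=> _ /mapP[s sS ->]; rewrite mem_filter mulVK sS /= mem_undup.
  by apply/allpairsP; exists (i, s); rewrite mem_iota.
(* For [g] in [P] some [s = e j g] is in [S], so [e i g = e i (e j)^-1 s] is a neighbour of [s] once
   it lies in [B]. *)
have PB i : (i < n)%N ->
    (count (fun g => `[< B (mul (e i) g) >]) P <= #|` nbh (reach n e B) S|)%N.
  move=> ni; rewrite -size_filter -(size_map (mul (e i)) [seq x <- P | _]).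
  apply: uniq_leq_size.
    by rewrite map_inj_uniq ?filter_uniq ?undup_uniq//; exact: mul_inj.
  move=> _ /mapP[g + ->]; rewrite mem_filter mem_undup => /andP[Bg].
  move=> /allpairsP[[j s] /= [jn sS eg]]; apply/nbhP; exists s => //.
  rewrite !inE Bg andbT; apply/allpairsP; exists (i, j).
  by rewrite mem_iota ni jn eg.
rewrite -(ler_nat Rdefinitions.R) -(ler_pM2l sw) !mulr_suml.
apply: (@le_trans _ _
  (\sum_(g <- P) \sum_(i < n) w i * (mul (e i) g \in S)%:R)).
  rewrite exchange_big /=; apply: ler_sum => i _.
  by rewrite -mulr_sumr ler_wpM2l ?w0// sumP ler_nat SP.
apply: (@le_trans _ _
  (\sum_(g <- P) \sum_(i < n) w i * (`[< B (mul (e i) g) >])%:R)).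
  apply: ler_sum => g _; apply: le_trans (AB g); apply: ler_sum => i _.
  rewrite ler_wpM2l ?w0// ler_nat; case: (boolP (_ \in S)) => // /SA ?.
  by rewrite asboolT.
rewrite exchange_big /=; apply: ler_sum => i _.
by rewrite -mulr_sumr ler_wpM2l ?w0// sumP ler_nat PB.
Qed.

(** Points are sorted by the first [k] in [ks] with [k a = phi a]. On each piece [phi] is a
    translation, so the injectivity of [phi] keeps the translates apart. *)
Lemma decomposition_of_matching (A B : set G) n e (phi : G -> G) :
  (forall a, A a -> phi a \in reach n e B a) ->
  (forall a a', A a -> A a' -> phi a = phi a' -> a = a') ->
  exists (n : nat) (P : nat -> set G) (g : nat -> G),
      [/\ A = \bigcup_(i in [set k | (k < n)%N]) P i,
          (forall i j, (i < n)%N -> (j < n)%N -> i <> j -> P i `&` P j = set0),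
          (forall i j, (i < n)%N -> (j < n)%N -> i <> j ->
              mul (g i) @` P i `&` mul (g j) @` P j = set0) &
          (forall i, (i < n)%N -> mul (g i) @` P i `<=` B)].
Proof.
move=> phiN phiI.
pose ks := [seq mul (e i) (inv (e j)) | i <- iota 0 n, j <- iota 0 n].
pose idx a := find (fun k => mul k a == phi a) ks.
pose P i := [set a | A a /\ idx a = i].
have idxP a : A a -> (idx a < size ks)%N /\ mul (nth one ks (idx a)) a = phi a.
  move=> /phiN; rewrite !inE => /andP[/allpairsP[[i j]] /= [i_n j_n pe] _].
  have h : has (fun k => mul k a == phi a) ks.
    apply/hasP; exists (mul (e i) (inv (e j))).
      by apply/allpairsP; exists (i, j).
    by rewrite pe (grp_mulA GP).
  by split; [rewrite -has_find|exact/eqP/(nth_find one h)].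
have Pphi i a : P i a -> mul (nth one ks i) a = phi a.
  by case=> aA <-; exact: (idxP a aA).2.
exists (size ks), P, (nth one ks); split.
- apply/seteqP; split => [a aA|a [i _ []]//].
  by exists (idx a); [exact: (idxP a aA).1|].
- by move=> i j _ _ ij; apply/seteqP; split => // a [[_ ai] [_ aj]]; apply: ij;
    rewrite -ai -aj.
- move=> i j _ _ ij; apply/seteqP; split => // b [[a Pa <-] [a' Pa' e']].
  have aa' : a' = a.
    by apply: phiI; [exact: Pa'.1|exact: Pa.1|rewrite -(Pphi i a Pa) -(Pphi j a' Pa')].
  by apply: ij; rewrite -Pa.2 -Pa'.2 aa'.
- move=> i _ _ [a Pa <-]; rewrite (Pphi i)//.
  by have := phiN a Pa.1; rewrite !inE => /andP[_ /asboolP].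
Qed.

Lemma mulVV x : mul (inv (inv x)) = mul x.
Proof.
apply/funext => y; apply: (@mul_inj (inv x)).
by rewrite mulVK mulK.
Qed.

Lemma fa_prob_of_inv (m : set G -> Rdefinitions.R) : inv_fa_prob mul m -> fa_prob m.
Proof. by case=> ? ? ? _; split. Qed.

Lemma translate_disjoint x (E F : set G) :
  E `&` F = set0 -> mul x @` E `&` mul x @` F = set0.
Proof.
rewrite !translateE => EF; apply/seteqP; split => // y [Ey Fy].
by have : (E `&` F) (mul (inv x) y) by []; rewrite EF.
Qed.

(** [M E] is the [m0]-mean of the function sending [x] to [m (x^-1 E)], so the inequality between
    [A] and [B] holds pointwise before averaging. *)
Lemma invariant_average (m0 m : set G -> Rdefinitions.R) (A B : set G) :
  inv_fa_prob mul m0 -> fa_prob m ->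
  (forall x, m (mul x @` B) <= m (mul x @` A)) ->
  exists M, inv_fa_prob mul M /\ M B <= M A.
Proof.
move=> m0I mP BA; have m0P := fa_prob_of_inv m0I.
have [L [LD Lle Lcst]] := @generalized_limit Rdefinitions.R.
pose f (E : set G) x := m (mul (inv x) @` E).
have f01 E : unit_fun (f E) by move=> x; rewrite /f (fa_ge0 mP) (fa_le1 mP).
pose M E := @mean_integral _ _ m0 L (f E).
have fU E F x : E `&` F = set0 -> f (E `|` F) x = f E x + f F x.
  by move=> EF; rewrite /f image_setU (fa_setU mP)//; exact: translate_disjoint.
have MU E F : E `&` F = set0 -> M (E `|` F) = M E + M F.
  by move=> EF; apply: (mean_integralD m0P LD Lle Lcst) => // x; exact: fU.
have M0 : M set0 = 0 by have := MU _ _ (set0I set0); rewrite setU0; lra.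
have Mle E F : (forall x, f E x <= f F x) -> M E <= M F.
  by move=> EF; exact: (mean_integral_le m0P LD Lle Lcst).
exists M; split; last by apply: Mle => x; exact: BA.
split=> [E||//|g E].
- by rewrite -M0; apply: Mle => x; rewrite /f image_set0 (fa_set0 mP) (fa_ge0 mP).
- rewrite -[RHS](mean_integral1 m0P LD Lle Lcst); congr mean_integral.
  apply/funext => x; rewrite /f -(fa_setT mP) translateE; congr m.
- rewrite /M /mean_integral; congr L; apply/funext => n.
  apply: eq_bigr => t _; congr (_ * _).
  (* Translating [E] by [g] translates [f E] and its rounded level sets, so the grid sums agree for
     each [n], before [L] is applied. *)
  have fg x : f (mul g @` E) x = f E (mul (inv g) x).
    rewrite /f !translateE; congr m; apply/funext => y.
    by rewrite /= !mulVV (grp_mulA GP).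
  have [_ _ _ /(_ g) m0g] := m0I; rewrite -[RHS]m0g [in RHS]translateE; congr m0.
  by apply/funext => x; apply: (congr1 (fun r => grid_floor n r = t)); exact: fg.
Qed.

Lemma fa_prob_dirac (g : G) : fa_prob (fun E : set G => (`[< E g >])%:R : Rdefinitions.R).
Proof.
split=> [E||E F EF]; [exact: ler0n|by rewrite asboolT|].
rewrite asbool_or -natrD; congr _%:R.
have [Eg|] := asboolP (E g); last by case: asboolP.
have [Fg|] := asboolP (F g); last by [].
by have : (E `&` F) g by []; rewrite EF.
Qed.

Lemma weights_of_mean_lt (A B : set G) : amenable mul ->
  (forall m, inv_fa_prob mul m -> m A < m B) ->
  exists (n : nat) (e : nat -> G) (w : nat -> Rdefinitions.R),
    [/\ forall i, (i < n)%N -> 0 <= w i, 0 < \sum_(i < n) w i &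
      forall g, \sum_(i < n) w i * (`[< A (mul (e i) g) >])%:R
             <= \sum_(i < n) w i * (`[< B (mul (e i) g) >])%:R].
Proof.
move=> [m0 m0I] AB.
(* An enumeration of [G], with [one] at numbers coding no element. *)
pose x i := odflt one (choice.unpickle i).
pose mix (c : Rdefinitions.R) (m m' : set G -> Rdefinitions.R) :=
  fun E => c * m E + (1 - c) * m' E.
pose f i (m : set G -> Rdefinitions.R) := m (mul (x i) @` B) - m (mul (x i) @` A).
have fa i : mix_affine mix (f i) by move=> c m m'; rewrite /f /mix; ring.
have D0 : [set m : set G -> Rdefinitions.R | fa_prob m] !=set0.
  by exists m0; exact: fa_prob_of_inv.
have cD : mix_closed mix [set m : set G -> Rdefinitions.R | fa_prob m].
  move=> c m m' /andP[c0 c1] mP m'P; split=> [E||E F EF]; rewrite /mix.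
  - by rewrite addr_ge0// mulr_ge0 ?(fa_ge0 mP) ?(fa_ge0 m'P)// subr_ge0.
  - by rewrite (fa_setT mP) (fa_setT m'P); ring.
  - by rewrite (fa_setU mP EF) (fa_setU m'P EF); ring.
have [mneg|/existsNP[n nneg]] := pselect (forall n, exists2 m,
    fa_prob m & forall i, (i < n)%N -> f i m < 0); last first.
  have [//|[w [w0 sw wP]]] := convex_alternative n D0 cD fa.
  (* The inequality is tested on the point mass at [g], which charges [x i E] exactly when
     [inv (x i) g] is in [E]; hence the inverses. *)
  exists n, (fun i => inv (x i)), w; split => // g.
  rewrite -subr_ge0 -sumrB; have := wP _ (fa_prob_dirac g).
  congr (0 <= _); apply: eq_bigr => i _.
  by rewrite /f !translateE mulrBr.
have /boolp.choice[m mP] : forall n, exists m, fa_prob m /\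
    forall i, (i < n)%N -> f i m < 0.
  by move=> n; have [m mP mf] := mneg n; exists m.
(* Each inequality holds strictly for [m n] from some [n] on, hence weakly in the limit; averaging
   then contradicts [AB]. *)
have [L [LD Lle Lcst]] := @generalized_limit Rdefinitions.R.
have mL := fa_prob_generalized_limit LD Lle Lcst (fun n => (mP n).1).
have [|M [MI MBA]] := @invariant_average m0 _ A B m0I mL; last first.
  by have := AB M MI; rewrite ltNge MBA.
move=> y; apply: Lle; try exact: (fa_bounded_seq _ (fun n => (mP n).1)).
exists (choice.pickle y).+1 => // n /= yn.
have := (mP n).2 _ yn; rewrite /f /x choice.pickleK /= subr_lt0; exact: ltW.
Qed.

Lemma equidecomposition_of_mean_lt (A B : set G) : amenable mul ->
  (forall m, inv_fa_prob mul m -> m A < m B) ->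
  exists (n : nat) (P : nat -> set G) (g : nat -> G),
      [/\ A = \bigcup_(i in [set k | (k < n)%N]) P i,
          (forall i j, (i < n)%N -> (j < n)%N -> i <> j -> P i `&` P j = set0),
          (forall i j, (i < n)%N -> (j < n)%N -> i <> j ->
              mul (g i) @` P i `&` mul (g j) @` P j = set0) &
          (forall i, (i < n)%N -> mul (g i) @` P i `<=` B)].
Proof.
move=> am /(weights_of_mean_lt am)[n [e [w [w0 sw AB]]]].
have [phi [phiN phiI]] := hall_matching (@hall_of_weights A B n e w w0 sw AB).
exact: decomposition_of_matching phiN phiI.
Qed.

(** * The action on the Stone-Cech compactification and invariant measures *)

Lemma beta_actK g : cancel (beta_act mul g) (beta_act mul (inv g)).
Proof.
move=> p; apply: betaG_ext => A.
suff e : mul g @^-1` (mul (inv g) @^-1` A) = A by rewrite -[in X in _ <-> X]e.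
by apply/funext => x; rewrite /preimage /= mulK.
Qed.

Lemma beta_actVK g : cancel (beta_act mul (inv g)) (beta_act mul g).
Proof.
move=> p; apply: betaG_ext => A.
suff e : mul (inv g) @^-1` (mul g @^-1` A) = A by rewrite -[in X in _ <-> X]e.
by apply/funext => x; rewrite /preimage /= mulVK.
Qed.

Lemma beta_act_image g (E : set (betaG G)) :
  beta_act mul g @` E = beta_act mul (inv g) @^-1` E.
Proof.
apply/seteqP; split => [_ [p pE <-]|p pE] /=; first by rewrite beta_actK.
by exists (beta_act mul (inv g) p) => //; rewrite beta_actVK.
Qed.

Lemma beta_act_imageK g (E : set (betaG G)) :
  beta_act mul (inv g) @` (beta_act mul g @` E) = E.
Proof.
rewrite image_comp -[RHS]image_id; congr image.
by apply/funext => p; exact: beta_actK.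
Qed.

Lemma beta_act_hat g (A : set G) : beta_act mul g @` hat A = hat (mul g @` A).
Proof. by rewrite beta_act_image translateE. Qed.

Lemma beta_act_open g (U : set (betaG G)) :
  beta_open U -> beta_open (beta_act mul g @` U).
Proof.
move=> oU _ [p /oU[A [pA AU]] <-]; exists (mul g @` A).
rewrite -!/(hat _ _) -[[set q | _]]/(hat _) -beta_act_hat; split.
  have : (beta_act mul g @` hat A) (beta_act mul g p) by exists p.
  by rewrite beta_act_hat.
exact: image_subset.
Qed.

Section InvariantExtension.
Context {m : set G -> Rdefinitions.R}.
Hypothesis mI : inv_fa_prob mul m.
Let mP : fa_prob m := fa_prob_of_inv mI.

(** One inequality suffices: applied to [inv g] it yields the reverse one. *)
Lemma inner_mass_act_le g (U : set (betaG G)) :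
  inner_mass (m := m) U <= inner_mass (m := m) (beta_act mul g @` U).
Proof.
apply: (inner_mass_le mP) => A AU; have [_ _ _ /(_ g A) <-] := mI.
by apply: (inner_mass_ge mP); rewrite -beta_act_hat; exact: image_subset.
Qed.

Lemma outer_mass_act_le g (E : set (betaG G)) :
  outer_mass (m := m) (beta_act mul g @` E) <= outer_mass (m := m) E.
Proof.
apply: (outer_mass_ge mP) => U oU EU.
apply: le_trans (outer_mass_le mP (beta_act_open (g := g) oU) (image_subset _ EU)) _.
apply: le_trans (inner_mass_act_le (inv g) _) _.
by rewrite beta_act_imageK.
Qed.

Lemma outer_mass_act g (E : set (betaG G)) :
  outer_mass (m := m) (beta_act mul g @` E) = outer_mass (m := m) E.
Proof.
apply/eqP; rewrite eq_le outer_mass_act_le /=.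
have := outer_mass_act_le (inv g) (beta_act mul g @` E).
by rewrite beta_act_imageK.
Qed.

Lemma radon_outer_mass : radon_prob (@beta_open G) (@outer_mass _ _ m).
Proof.
split.
- by move=> E _; exact: outer_mass_ge0.
- exact: outer_mass_setT.
- exact: outer_mass_sigma_additive.
(* Inner regularity is outer regularity of the complement, closed sets being compact. *)
- move=> E bE e e0; have [U [oU EU Ue]] := outer_mass_approx mP (~` E) e0.
  exists (~` U); split.
  + by apply: closed_compact; rewrite setCK.
  + by apply: beta_borelC; exact: beta_borel_open.
  + by rewrite -[E]setCK; exact: subsetC.
  + rewrite (outer_mass_setC mP); last exact: beta_borel_open.
    by move: Ue; rewrite (outer_mass_setC mP bE) (outer_mass_open mP oU); lra.
- move=> E bE e e0; have [U [oU EU Ue]] := outer_mass_approx mP E e0.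
  by exists U; split => //; rewrite (outer_mass_open mP oU).
Qed.

End InvariantExtension.

Lemma beta_dyn_comparison :
  amenable mul -> dyn_comparison (@beta_open G) (beta_act mul).
Proof.
move=> am A B /clopenE -> /clopenE -> _ _ AB.
have [|n [P [g [AP dP dgP gPB]]]] := @equidecomposition_of_mean_lt (trace A) (trace B) am.
  move=> m mI; have mP := fa_prob_of_inv mI.
  rewrite -!(outer_mass_hat mP); apply: AB; first exact: radon_outer_mass.
  by move=> h E _; exact: outer_mass_act.
exists n, (fun i => hat (P i)), g; split.
- by move=> i _; exact: clopen_hat.
(* [hat] commutes with finite unions, hence an induction on the number of pieces. *)
- rewrite AP; elim: n {AP dP dgP gPB} => [|n IH].
    by rewrite !bigcup0 ?hat0.
  by rewrite !bigcup_mkord in IH *; rewrite !big_ord_recr /= hatU IH.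
- by move=> i j ni nj ij; rewrite -hatI (dP i j)// hat0.
- by move=> i j ni nj ij; rewrite !beta_act_hat -hatI (dgP i j)// hat0.
- by move=> i ni; rewrite beta_act_hat; apply: hatS; exact: gPB.
Qed.

End Translates.

Unset Implicit Arguments.

Theorem theoremt (G : countType) (mul : G -> G -> G) (one : G) (inv : G -> G) :
  is_group mul one inv -> amenable mul ->
  dyn_comparison (@beta_open G) (beta_act mul) /\
  (forall A B : set G,
    (forall m, inv_fa_prob mul m -> m A < m B) ->
    exists (n : nat) (P : nat -> set G) (g : nat -> G),
      [/\ A = \bigcup_(i in [set k | (k < n)%N]) P i,
          (forall i j, (i < n)%N -> (j < n)%N -> i <> j -> P i `&` P j = set0),
          (forall i j, (i < n)%N -> (j < n)%N -> i <> j ->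
              mul (g i) @` P i `&` mul (g j) @` P j = set0) &
          (forall i, (i < n)%N -> mul (g i) @` P i `<=` B)]).
Proof.
move=> GP am; split; first exact: beta_dyn_comparison GP am.
by move=> A B AB; exact: equidecomposition_of_mean_lt GP _ _ am AB.
Qed.
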